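(* There is a crowded, separable, submaximal $T_2$ space $Y$ of cardinality $\mathfrak c$.
   Context: A space is crowded if it has no isolated points. A space is submaximal if all of its dense subsets are open. $\mathfrak c=2^{\omega}$ is the cardinality of the continuum. *)

(* Defs.v *)
From HB Require Import structures.
From mathcomp Require Import all_boot all_order.
From mathcomp Require Import boolp classical_sets functions cardinality topology.

Set Implicit Arguments.
Unset Strict Implicit.
Unset Printing Implicit Defensive.

Local Open Scope classical_set_scope.

Definition crowded (T : topologicalType) : Prop := isolated [set: T] = set0.

Definition separable (T : topologicalType) : Prop :=
  exists2 D : set T, countable D & dense D.

Definition submaximal (T : topologicalType) : Prop :=
  forall D : set T, dense D -> open D.

(* Main.v *)
Require Import Defs.
From HB Require Import structures.
From mathcomp Require Import all_boot all_order.
From mathcomp Require Import boolp classical_sets functions cardinality topology.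
From mathcomp Require Import cantor.

Set Implicit Arguments.
Unset Strict Implicit.
Unset Printing Implicit Defensive.

Local Open Scope classical_set_scope.
Local Open Scope card_scope.

(** The space is a refinement of the topology of the Cantor space [X], maximal
    among those that keep certain sets dense.

    Take a topological space [X] and a family [E] of dense sets closed under
    binary intersection.  Zorn's lemma, applied to the families of sets that
    contain the open sets, are closed under binary intersection, and whose
    nonempty members all meet every member of [E], yields a maximal such
    family [M] ([maximal_dense_refinement]).  Adjoining one more set [A] to [M]
    creates only the new members [U `&` A] with [U] in [M]; hence [A] already
    belongs to [M] as soon as each nonempty [U `&` A] meets every member of [E]
    ([maximal_absorbs]).  This criterion gives everything at once:
    - a union of members of [M] is in [M], so [M] is a topology;
    - a member [A] of [E] is in [M]: if [C] is in [E], so is [A `&` C], and [U]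
      meets it;
    - an [M]-dense set [D] is in [M]: for [C] in [E], the set [U `&` C] is
      nonempty and, by the previous item, open, so it meets [D].
    The last item is submaximality ([submaximal_refinement]).

    Now let [X] be crowded and Hausdorff with a countable dense set [S], and
    let [E] consist of the traces on [S] of the dense open sets.  The sets [S]
    and [S `\ x], for every point [x], are in [E]: that [S] stays dense makes
    the refinement separable, and that [S `\ x] stays dense prevents [x] from
    being isolated.  Refining preserves the Hausdorff property and the
    underlying set, so the Cantor space yields the required cardinality. *)

Section topology_of_opens.
Variables (T : choiceType) (M : set_system T).
Hypotheses (MT : M setT) (MI : setI_closed M).
Hypothesis MU : forall (I : Type) (F : I -> set T),
  (forall i, M (F i)) -> M (\bigcup_i F i).

(** A copy of [T], so that the topology given by [M] does not clash with one
    that [T] may already carry. *)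
Definition retopologized : Type := T.
Local Notation Y := retopologized.

HB.instance Definition _ := Choice.on Y.
HB.instance Definition _ := isOpenTopological.Build Y MT MI MU.

Lemma topology_of_opens :
  exists (Y : topologicalType) (f : Y -> T) (g : T -> Y),
    [/\ cancel f g, cancel g f & forall A : set Y, open A <-> M (g @^-1` A)].
Proof. by exists Y, id, id. Qed.

End topology_of_opens.

Section maximal_refinement.
Variables (X : topologicalType) (E : set_system X).
Hypotheses (EI : setI_closed E) (Ed : E `<=` dense (T := X)).

Definition dense_refinement (B : set_system X) :=
  [/\ @open X `<=` B, setI_closed B &
      forall U A, B U -> U !=set0 -> E A -> U `&` A !=set0].

(** In Zorn's lemma the union of the empty chain is the empty family, which is
    no refinement; the predicate [P] below therefore also admits the empty
    family, and maximality excludes it afterwards. *)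
Lemma maximal_dense_refinement :
  exists2 M, dense_refinement M &
    forall B, dense_refinement B -> M `<=` B -> B `<=` M.
Proof.
pose P (B : set_system X) := B !=set0 -> dense_refinement B.
have refX : dense_refinement (@open X).
  by split=> [//|A B|U A oU U0 /Ed]; [exact: openI|exact].
have [F FP Ftot|M [PM maxM]] := @Zorn_bigcup _ P.
  move=> [A0 [B0 FB0 B0A0]].
  have refF B A : F B -> B A -> dense_refinement B.
    by move=> FB BA; apply: FP => //; exists A.
  split.
  - have [sub _ _] := refF _ _ FB0 B0A0.
    by move=> U oU; exists B0 => //; exact: sub.
  - move=> U V [B FB BU] [C FC CV].
    have [BC|CB] := Ftot _ _ FB FC.
    + by exists C => //; have [_ + _] := refF _ _ FC CV; apply=> //; exact: BC.
    + by exists B => //; have [_ + _] := refF _ _ FB BU; apply=> //; exact: CB.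
  - by move=> U A [B FB BU]; have [_ _] := refF _ _ FB BU; apply.
have maxP B : P B -> M `<=` B -> B `<=` M.
  by move=> PB MB; apply: contrapT => BM; apply: (maxM B).
have refM : dense_refinement M.
  apply: PM; apply: contrapT => /set0P/negP/negPn/eqP M0.
  suff : M setT by rewrite M0.
  by apply: (maxP _ (fun=> refX)); [rewrite M0; exact: sub0set|exact: openT].
by exists M => // B refB; exact: maxP.
Qed.

(** The family generated by [M] and [A] consists of the [U] and [U `&` A] with
    [U] in [M]; the hypothesis on [A] makes it a [dense_refinement]. *)
Lemma maximal_absorbs M (A : set X) :
    dense_refinement M ->
    (forall B, dense_refinement B -> M `<=` B -> B `<=` M) ->
    (forall U C, M U -> E C -> U `&` A !=set0 -> U `&` A `&` C !=set0) ->
  M A.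
Proof.
move=> [oM MI Md] maxM MA.
have MT : M setT by apply: oM; exact: openT.
pose B := M `|` [set U `&` A | U in M].
suff refB : dense_refinement B.
  by apply: (maxM _ refB); [exact: subsetUl|right; exists setT; rewrite ?setTI].
split.
- by move=> U /oM; left.
- move=> U' V' [MU|[U MU <-]] [MV|[V MV <-]].
  + by left; exact: MI.
  + by right; exists (U' `&` V); rewrite ?setIA//; exact: MI.
  + by right; exists (U `&` V'); rewrite 1?setIAC//; exact: MI.
  + by right; exists (U `&` V); [exact: MI|rewrite setIACA setIid].
- by move=> U' C [MU|[U MU <-]] U0 EC; [exact: Md|exact: MA].
Qed.

(** Every set whose membership in [M] is at stake (a union, a member of [E], a
    dense set) is handled by [maximal_absorbs]. *)
Theorem submaximal_refinement :
  exists (Y : topologicalType) (f : Y -> X),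
    [/\ bijective f, continuous f, submaximal Y &
        forall A, E A -> dense (f @^-1` A)].
Proof.
have [M refM maxM] := maximal_dense_refinement.
have absorb A := @maximal_absorbs M A refM maxM.
have [oM MI Md] := refM.
have MT : M setT by apply: oM; exact: openT.
have Mcup I (F : I -> set X) : (forall i, M (F i)) -> M (\bigcup_i F i).
  move=> MF; apply: absorb => U C MU EC [x [Ux [i _ Fix]]].
  have [|y [[Uy Fiy] Cy]] := Md (U `&` F i) C (MI _ _ MU (MF i)) _ EC.
    by exists x.
  by exists y; split=> //; split=> //; exists i.
have ME A : E A -> M A.
  move=> EA; apply: absorb => U C MU EC [x [Ux _]].
  by rewrite -setIA; apply: Md => //; [exists x|exact: EI].
have [Y [f [g [fK gK openY]]]] := topology_of_opens MT MI Mcup.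
have fgE (A : set X) : g @^-1` (f @^-1` A) = A.
  by apply/seteqP; split=> x; rewrite /= gK.
exists Y, f; split.
- by exists g.
- by apply/continuousP => A oA; rewrite openY fgE; exact: oM.
(* [D] is open because it meets the nonempty open set [U `&` C]. *)
- move=> D denseD; rewrite openY; apply: absorb => U C MU EC [x [Ux _]].
  have [||y [[Uy Cy] Dy]] := denseD (f @^-1` (U `&` C)).
  + have [|y UCy] := Md U C MU _ EC; first by exists x.
    by exists (g y); rewrite /= gK.
  + by rewrite openY fgE; apply: MI => //; exact: ME.
  + by exists (f y); rewrite /preimage/= fK.
- move=> A EA U [y Uy]; rewrite openY => MU.
  have [|x [Ux Ax]] := Md _ A MU _ EA; first by exists (f y); rewrite /= fK.
  by exists (g x); rewrite /= gK.
Qed.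

End maximal_refinement.

Lemma crowdedP (T : topologicalType) :
  crowded T <-> forall x : T, ~ open [set x].
Proof.
rewrite /crowded -subset0; split=> [T0 x ox|T0 x [_ [V Vx]]].
  apply: (T0 x); split; first exact: in_setT.
  by exists [set x]; [exact: open_nbhs_nbhs|rewrite setIT].
rewrite setIT => VE; apply: (T0 x).
by rewrite openE => _ ->; rewrite -VE.
Qed.

Lemma hausdorff_continuous_injective (S T : topologicalType) (f : S -> T) :
  continuous f -> injective f -> hausdorff_space T -> hausdorff_space S.
Proof.
move=> cf fI hT x y xy; apply/fI/hT => A B fxA fyB.
have [z [Az Bz]] := xy _ _ (cf x _ fxA) (cf y _ fyB).
by exists (f z).
Qed.

(** Traces on [S] of dense open sets, rather than the sets [S `\ x] alone, are
    kept dense because they are stable under intersection. *)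
Theorem separable_submaximal_refinement (X : topologicalType) :
    crowded X -> separable X -> hausdorff_space X ->
  exists (Y : topologicalType) (f : Y -> X),
    [/\ bijective f, continuous f &
        [/\ crowded Y, separable Y, submaximal Y & hausdorff_space Y]].
Proof.
move=> /crowdedP cX [S cS dS] hX.
pose E := [set S `&` O | O in [set O | open O /\ dense O]].
have EI : setI_closed E.
  move=> _ _ [O [oO dO] <-] [O' [oO' dO'] <-]; exists (O `&` O').
    by split; [exact: openI|exact: denseI].
  by rewrite setIACA setIid.
have Ed : E `<=` dense (T := X).
  by move=> _ [O [oO dO] <-]; rewrite setIC; exact: denseI.
have [Y [f [fbij fc subY dY]]] := submaximal_refinement EI Ed.
have finj := bij_inj fbij.
exists Y, f; split=> //; split=> //.
- apply/crowdedP => y oy.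
  have EfyS : E (S `&` ~` [set f y]).
    exists (~` [set f y]) => //; split.
      by rewrite openC; exact: accessible_closed_set1 (hausdorff_accessible hX) _.
    (* A nonempty open set missing the complement of [f y] is the singleton of [f y],
       an isolated point. *)
    move=> O [x Ox] oO; apply: contrapT => OC; apply: (cX x).
    suff -> : [set x] = O by [].
    have Ofy z : O z -> z = f y.
      by move=> Oz; apply: contrapT => zy; apply: OC; exists z.
    by apply/seteqP; split=> [z ->//|z Oz]; rewrite /= (Ofy z)// (Ofy x).
  have [|_ [-> [_]]] := dY _ EfyS [set y] _ oy; first by exists y.
  by apply.
- have [g fK gK] := fbij.
  exists (f @^-1` S); last first.
    apply: dY; exists setT; rewrite ?setIT//.
    by split; [exact: openT|move=> O O0 _; rewrite setIT].
  rewrite (_ : f @^-1` S = g @` S).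
    exact: sub_countable (card_image_le _ _) cS.
  apply/seteqP; split=> [y Sy|_ [x Sx <-]]; last by rewrite /= gK.
  by exists (f y).
- exact: hausdorff_continuous_injective hX.
Qed.

Lemma cantor_crowded : crowded cantor_space.
Proof.
by apply/crowdedP; apply/perfectTP; exact: cantor_perfect.
Qed.

(** The eventually false sequences are dense: the truncations of [x] converge
    to [x] coordinatewise. *)
Lemma cantor_separable : separable cantor_space.
Proof.
exists (range (fun (s : seq bool) n => nth false s n)).
  exact: sub_countable (card_image_le _ _) (countableP _).
move=> O [x Ox] oO.
pose g (N : nat) : cantor_space := nth false (mkseq x N).
have gx : g @ \oo --> x.
  apply/cvg_sup => n U [V] [[W] oW <-] Wx WU.
  apply: (filterS WU); rewrite nbhs_simpl /g; exists n.+1 => // i /= ni.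
  by rewrite nth_mkseq.
have [N _ gO] := gx O (open_nbhs_nbhs (conj oO Ox)).
by exists (g N); split; [exact: gO (leqnn N)|exists (mkseq x N)].
Qed.

Theorem theorem4p4 :
  exists Y : topologicalType,
    [/\ crowded Y, separable Y, submaximal Y, hausdorff_space Y
      & [set: Y] #= [set: nat -> bool]].
Proof.
have [Y [f [fbij _ [cY sY mY hY]]]] := separable_submaximal_refinement
  cantor_crowded cantor_separable cantor_space_hausdorff.
exists Y; split=> //.
by apply: (@pcard_eq _ cantor_space); have [F _] := PbijTT fbij; exact: F.
Qed.
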